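(* Let $X$ be a separable reflexive Banach space. Assume that $X$ has an unconditional asymptotic structure and that $\mathrm{Sz}(X^* )>\omega$. Then $X$ contains good $\ell_\infty$-trees of arbitrary height almost isometrically.
   Context: $\mathrm{cof}(X)$ denotes the set of (closed) finite-codimensional subspaces of $X$, $S_Z$ the unit sphere of $Z$, $B_Z$ the closed unit ball. Unconditional asymptotic structure: a finite sequence $(x_j)_{j=1}^n$ is $C$-unconditional if $\|\sum_j\epsilon_j a_jx_j\|\le C\|\sum_j a_jx_j\|$ for all scalars $a_j$ and signs $\epsilon_j=\pm1$. $X$ has an unconditional asymptotic structure if there is $C\ge1$ such that for all $n\in\mathbb{N}$: $\exists X_1\in\mathrm{cof}(X)\ \forall x_1\in S_{X_1}\ \ldots\ \exists X_n\in\mathrm{cof}(X)\ \forall x_n\in S_{X_n}$, $(x_j)_{j=1}^n$ is $C$-unconditional. Szlenk index of a separable Banach space $Z$: for a weak$^*$-compact $K\subset Z^*$ and $\varepsilon>0$, $s_\varepsilon(K)$ is $K$ minus the union of all relatively weak$^*$-open subsets of $K$ of norm diameter less than $\varepsilon$; $s_\varepsilon^0(K)=K$, $s_\varepsilon^{\alpha+1}(K)=s_\varepsilon(s_\varepsilon^\alpha(K))$, and $s_\varepsilon^\alpha(K)=\bigcap_{\beta<\alpha}s_\varepsilon^\beta(K)$ for limit $\alpha$. $\mathrm{Sz}(Z,\varepsilon)$ is the least ordinal $\alpha$ with $s_\varepsilon^\alpha(B_{Z^*})=\emptyset$ if it exists and $\infty$ otherwise; $\mathrm{Sz}(Z)=\sup_{\varepsilon>0}\mathrm{Sz}(Z,\varepsilon)$.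 $\omega$ is the first infinite ordinal. (Here it is used for $Z=X^*$, so $Z^*=X$.) $[\mathbb{N}]^{\le n}$ is the set of subsets of $\mathbb{N}=\{1,2,\dots\}$ with at most $n$ elements (including $\emptyset$), $[\mathbb{N}]^n$ those with exactly $n$ elements, written in increasing order; $\max(\emptyset):=0$. An enumeration $(A_i)_{i\in\mathbb{N}}$ of $[\mathbb{N}]^{\le n}$ is a compatible linear ordering if $\max(A_i)<\max(A_j)$ implies $i<j$. $X$ contains $(C,D)$-good $\ell_\infty$-trees of arbitrary height ($C,D\ge1$) if for any $n\in\mathbb{N}$ and any compatible linear ordering $(A_i)_{i\in\mathbb{N}}$ of $[\mathbb{N}]^{\le n}$ there are $(x_A)_{A\in[\mathbb{N}]^{\le n}}$ in $S_X$ and $(x_A^* )_{A\in[\mathbb{N}]^{\le n}}$ in $S_{X^*}$ such that: (a) $x_A^*(x_A)=1$ and $x_A^*(x_B)=0$ for all $A,B\in[\mathbb{N}]^{\le n}$ with $\max(B)>\max(A)$; (b) $\frac1C\|(a_i)_{i=0}^n\|_\infty\le\|a_0x_\emptyset+a_1x_{\{b_1\}}+\cdots+a_nx_{\{b_1,\dots,b_n\}}\|\le C\|(a_i)_{i=0}^n\|_\infty$ for all $(a_i)_{i=0}^n\subset\mathbb{R}$ and all $\{b_1<\dots<b_n\}\in[\mathbb{N}]^n$; (c) $\|\sum_{m=1}^ia_mx_{A_m}\|\le D\|\sum_{m=1}^ja_mx_{A_m}\|$ for all $i\le j$ and all real $(a_m)_{m=1}^j$. $X$ contains good $\ell_\infty$-trees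 of arbitrary height almost isometrically if it contains $(1+\varepsilon,1+\varepsilon)$-good $\ell_\infty$-trees of arbitrary height for every $\varepsilon>0$. *)

(* Defs.v *)
From HB Require Import structures.
From mathcomp Require Import all_boot all_order all_algebra finmap.
From mathcomp Require Import all_classical all_reals all_analysis.

Set Implicit Arguments.
Unset Strict Implicit.
Unset Printing Implicit Defensive.

Import Order.TTheory GRing.Theory Num.Theory.
Import numFieldNormedType.Exports.

Local Open Scope classical_set_scope.
Local Open Scope ring_scope.

Definition dual_pred (R : realType) (X : normedModType R) :
  {pred X -> R^o} := fun f => `[< linear f /\ continuous f >].

Section dual_submod.
Context (R : realType) (X : normedModType R).

Fact dual_submod_closed : submod_closed (@dual_pred R X).
Proof.
split=> [|a f g /asboolP[lf cf] /asboolP[lg cg]]; apply/asboolP; split.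
- by move=> k u v; rewrite [LHS](_ : _ = 0)// [RHS](_ : _ = k *: 0 + 0)//
    scaler0 addr0.
- exact: cst_continuous.
- move=> k u v; rewrite [LHS](_ : _ = a *: f (k *: u + v) + g (k *: u + v))//.
  rewrite [RHS](_ : _ = k *: (a *: f u + g u) + (a *: f v + g v))//.
  rewrite lf lg !scalerDr !scalerA (mulrC a) -!addrA.
  by congr (_ + _); rewrite addrCA.
- by move=> x; apply: cvgD; [apply: cvgZr; exact: cf|exact: cg].
Qed.

HB.instance Definition _ := GRing.isSubmodClosed.Build R (X -> R^o)
  (@dual_pred R X) dual_submod_closed.

End dual_submod.

Record dual (R : realType) (X : normedModType R) := Dual {
  dual_fun :> X -> R^o ;
  _ : dual_fun \in @dual_pred R X }.

Section dual_normed.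
Context (R : realType) (X : normedModType R).

HB.instance Definition _ := [isSub for @dual_fun R X].
HB.instance Definition _ := [Choice of dual X by <:].
HB.instance Definition _ := [SubChoice_isSubLmodule of dual X by <:].

Lemma dual_linear (f : dual X) : linear f.
Proof. by have /asboolP[] := valP f. Qed.

Lemma dual_continuous (f : dual X) : continuous f.
Proof. by have /asboolP[] := valP f. Qed.

HB.instance Definition _ (f : dual X) :=
  GRing.isLinear.Build R X R^o *:%R f (dual_linear f).

Definition dual_norm (f : dual X) : R :=
  sup [set `|f x| | x in [set x : X | `|x| <= 1]].

Lemma dual_norm_has_sup (f : dual X) :
  has_sup [set `|f x| | x in [set x : X | `|x| <= 1]].
Proof.
split; first by exists `|f 0|, 0 => //=; rewrite normr0.
have /linear_bounded_continuous/linear_boundedP := @dual_continuous f.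
move=> /pinfty_ex_gt0[r r0 rf]; exists r => _ [x /= x1 <-].
by rewrite (le_trans (rf x))// ler_piMr// ltW.
Qed.

Lemma dual_norm_ub (f : dual X) x : `|x| <= 1 -> `|f x| <= dual_norm f.
Proof.
by move=> x1; apply: ub_le_sup; [case: (dual_norm_has_sup f)|exists x].
Qed.

Lemma dual_norm_le (f : dual X) r :
  (forall x, `|x| <= 1 -> `|f x| <= r) -> dual_norm f <= r.
Proof.
move=> fr; apply: ge_sup; first by case: (dual_norm_has_sup f).
by move=> _ [x x1 <-]; exact: fr.
Qed.

Lemma dual_normP (f : dual X) x : `|f x| <= dual_norm f * `|x|.
Proof.
have [->|x0] := eqVneq x 0; first by rewrite linear0 !normr0 mulr0.
have x0' : 0 < `|x| by rewrite normr_gt0.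
rewrite -ler_pdivrMr//.
have -> : `|f x| / `|x| = `|f (`|x|^-1 *: x)|.
  by rewrite linearZ normrZ normfV normr_id mulrC.
by apply: dual_norm_ub; rewrite normrZ normfV normr_id mulVf// gt_eqF.
Qed.

Lemma dual_norm_ge0 (f : dual X) : 0 <= dual_norm f.
Proof. by rewrite (le_trans (normr_ge0 (f 0)))// dual_norm_ub// normr0. Qed.

Lemma dual_normD (f g : dual X) :
  dual_norm (f + g) <= dual_norm f + dual_norm g.
Proof.
apply: dual_norm_le => x x1.
by rewrite (le_trans (ler_normD _ _))// lerD// dual_norm_ub.
Qed.

Lemma dual_normZ (k : R) (f : dual X) :
  dual_norm (k *: f) = `|k| * dual_norm f.
Proof.
have le (c : R) (g : dual X) : dual_norm (c *: g) <= `|c| * dual_norm g.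
  apply: dual_norm_le => x x1.
  by rewrite [X in X <= _]normrM ler_wpM2l// dual_norm_ub.
apply/eqP; rewrite eq_le le/=.
have [->|k0] := eqVneq k 0; first by rewrite normr0 mul0r dual_norm_ge0.
rewrite -ler_pdivlMl ?normr_gt0// -normfV.
by rewrite -{1}[f]scale1r -(mulVf k0) -scalerA le.
Qed.

Lemma dual_norm0_eq0 (f : dual X) : dual_norm f = 0 -> f = 0.
Proof.
move=> f0; apply/val_inj/funext => x /=.
by apply/normr0_eq0/le_anti; rewrite normr_ge0 (le_trans (dual_normP f x))// f0 mul0r.
Qed.

HB.instance Definition _ := Lmodule_isNormed.Build R (dual X)
  dual_normD dual_normZ dual_norm0_eq0.

End dual_normed.

Definition separable_space (T : topologicalType) :=
  exists2 D : set T, countable D & dense D.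

(** The canonical embedding of X into its bidual is onto. *)
Definition reflexive_space (R : realType) (X : normedModType R) :=
  forall phi : dual (dual X), exists x : X, forall f : dual X, phi f = f x.

Definition linear_subspace (R : realType) (X : normedModType R) (Y : set X) :=
  Y 0 /\ forall (a : R) (x y : X), Y x -> Y y -> Y (a *: x + y).

Definition finite_codim (R : realType) (X : normedModType R) (Y : set X) :=
  exists n (v : 'I_n -> X), forall x : X, exists2 y, Y y &
    exists c : 'I_n -> R, x = y + \sum_(i < n) c i *: v i.

Definition cof (R : realType) (X : normedModType R) : set (set X) :=
  [set Y | [/\ linear_subspace Y, closed Y & finite_codim Y]].

Definition unconditional (R : realType) (X : normedModType R) (C : R)
    (s : seq X) :=
  forall (a : nat -> R) (e : nat -> bool),
    `|\sum_(i < size s) ((-1) ^+ e i * a i) *: s`_i|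
      <= C * `|\sum_(i < size s) a i *: s`_i|.

(** [unconditional_game C n s] is the statement
    "exists X_1 in cof(X), forall x_1 in S_{X_1}, ..., exists X_n in cof(X),
    forall x_n in S_{X_n}, s followed by (x_1, ..., x_n) is C-unconditional". *)
Fixpoint unconditional_game (R : realType) (X : normedModType R) (C : R)
    (n : nat) (s : seq X) : Prop :=
  if n is m.+1 then
    exists2 Y : set X, cof Y &
      forall x, Y x -> `|x| = 1 -> unconditional_game C m (rcons s x)
  else unconditional C s.

Definition unconditional_asymptotic_structure (R : realType)
    (X : normedModType R) :=
  exists2 C : R, 1 <= C & forall n, @unconditional_game R X C n [::].

(** Ordinals presented as well-founded trees; [osup f] is the supremum of the
    family [f], so every limit ordinal is [osup] of the family of the smaller
    ordinals.  Distinct trees may denote the same ordinal: the order is [ole],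
    and equality of ordinals is [ole] in both directions. *)
Inductive ord : Type :=
| ozero : ord
| osucc : ord -> ord
| osup : forall I : Type, (I -> ord) -> ord.

Fixpoint ole (a b : ord) {struct a} : Prop :=
  match a with
  | ozero => True
  | osucc a' =>
      (fix lt (b : ord) : Prop :=
         match b with
         | ozero => False
         | osucc b' => ole a' b'
         | osup _ g => exists j, lt (g j)
         end) b
  | osup _ f => forall i, ole (f i) b
  end.

Definition olt (a b : ord) : Prop := ole (osucc a) b.

Definition omega : ord := osup (fun n : nat => iter n osucc ozero).

(** Ordinals extended with [None] standing for infinity. *)
Definition xord := option ord.

Definition xolt (a b : xord) : Prop :=
  match a, b with
  | None, _ => False
  | Some _, None => True
  | Some a', Some b' => olt a' b'
  end.

Definition xosup (I : Type) (f : I -> xord) : xord :=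
  if pselect (exists i, f i = None) then None
  else Some (osup (fun i => odflt ozero (f i))).

Definition oleast (P : ord -> Prop) : xord :=
  match pselect (exists a, P a /\ forall b, P b -> ole a b) with
  | left h => Some (projT1 (cid h))
  | right _ => None
  end.

Section szlenk.
Context (R : realType) (Z : normedModType R).

Definition weak_star : Type :=
  initial_topology (fun f : dual Z => (f : {ptws Z -> R^o})).
HB.instance Definition _ := Topological.on weak_star.

Definition relatively_weak_star_open (K U : set (dual Z)) :=
  exists2 V : set (dual Z), open (V : set weak_star) & U = K `&` V.

Definition diameter (U : set (dual Z)) : \bar R :=
  ereal_sup [set (`|fg.1 - fg.2|)%:E | fg in U `*` U].

Definition szlenk_derivative (e : R) (K : set (dual Z)) : set (dual Z) :=
  K `\` \bigcup_(U in [set U | relatively_weak_star_open K U /\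
                               (diameter U < e%:E)%E]) U.

(** The intersection with [K] only matters when [I] is empty, in which case
    [osup f] is the ordinal 0. *)
Fixpoint szlenk_iter (e : R) (K : set (dual Z)) (a : ord) : set (dual Z) :=
  match a with
  | ozero => K
  | osucc b => szlenk_derivative e (szlenk_iter e K b)
  | osup _ f => K `&` \bigcap_i szlenk_iter e K (f i)
  end.

Definition dual_ball : set (dual Z) := [set f | `|f| <= 1].

Definition szlenk_index_at (e : R) : xord :=
  oleast (fun a => szlenk_iter e dual_ball a = set0).

Definition szlenk_index : xord :=
  xosup (fun e : {posnum R} => szlenk_index_at e%:num).

End szlenk.

Arguments szlenk_index {R} Z.

(** N starts at 1, hence the positivity of the elements. *)
Definition Nle (n : nat) : set {fset nat} :=
  [set A | (#|` A| <= n)%N /\ forall k, k \in A -> (0 < k)%N].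

(** The empty maximum is 0. *)
Definition fmax (A : {fset nat}) : nat := (\max_(k <- A) k)%N.

(** Enumerations are indexed from 0 rather than from 1. *)
Definition compatible_ordering (n : nat) (A : nat -> {fset nat}) :=
  set_bij [set: nat] (Nle n) A /\
  forall i j, (fmax (A i) < fmax (A j))%N -> (i < j)%N.

(** In the third clause [b] lists b_1 < ... < b_n, and [take i b] is the
    branch node {b_1, ..., b_i}. *)
Definition good_linfty_trees (R : realType) (X : normedModType R) (C D : R) :=
  forall (n : nat) (A : nat -> {fset nat}), (0 < n)%N ->
    compatible_ordering n A ->
  exists (x : {fset nat} -> X) (xs : {fset nat} -> dual X),
    [/\ forall B, Nle n B -> `|x B| = 1 /\ `|xs B| = 1,
        forall B, Nle n B -> xs B (x B) = 1 /\
          forall B', Nle n B' -> (fmax B < fmax B')%N -> xs B (x B') = 0,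
        forall (a : 'I_n.+1 -> R) (b : n.-tuple nat),
          sorted ltn b -> all (leq 1) b ->
          let N := \big[Num.max/0]_(i < n.+1) `|a i| in
          let y := \sum_(i < n.+1) a i *: x [fset k in take i b]%fset in
          C^-1 * N <= `|y| /\ `|y| <= C * N
      & forall (i j : nat) (a : nat -> R), (i <= j)%N ->
          `|\sum_(m < i) a m *: x (A m)| <= D * `|\sum_(m < j) a m *: x (A m)|].

Definition good_linfty_trees_almost_isometrically (R : realType)
    (X : normedModType R) :=
  forall e : R, 0 < e -> good_linfty_trees X (1 + e) (1 + e).

(* Main.v *)
(** The argument is a game in which the first player names a finite set of
    functionals and the second answers with a unit vector of their common
    kernel. As the Szlenk index of the dual of [X] exceeds [omega] and [X]
    is reflexive, for some [e > 0] every finite Szlenk derivative of the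
    ball of [X] is nonempty: each point of a derivative has, weakly close to
    it, points of the previous one at distance at least [e / 4]. Walking
    down the derivatives, the second player produces unit vectors, perturbed
    by arbitrarily little, with a combination of bounded norm whose
    coefficients are bounded below. Playing inside the subspaces given by
    the unconditional asymptotic structure, this becomes a bound [M] for all
    combinations with coefficients in [-1, 1]. James' blocking argument, run
    on strategies, replaces [M] by [sqrt M], hence by [1 + d]; for unit
    vectors that upper bound implies the lower bound [1 - d]. The tree is
    then built along the ordering: at each node the second player follows
    the strategy on the branch, against a first player who names the norming
    functionals of the earlier vectors and, as in Mazur's construction of
    basic sequences, functionals almost norming their span. *)

From HB Require Import structures.
Require Import Defs.
From mathcomp Require Import all_boot all_order all_algebra finmap.
From mathcomp Require Import all_classical all_reals all_analysis.
From mathcomp Require Import ring lra.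

Set Implicit Arguments.
Unset Strict Implicit.
Unset Printing Implicit Defensive.

Import Order.TTheory GRing.Theory Num.Theory.
Import numFieldNormedType.Exports.

Local Open Scope classical_set_scope.
Local Open Scope ring_scope.

(** * The Hahn-Banach theorem by minimal sublinear functionals *)

Section sublinear_functionals.
Context (R : realType) (V : lmodType R).

(** Homogeneity is an inequality for positive [t], a form that passes to infima; scaling back by
    [t^-1] turns it into an equality. *)
Definition sublinear (p : V -> R) :=
  (forall x y, p (x + y) <= p x + p y) /\
  (forall t x, 0 < t -> p (t *: x) <= t * p x).

Implicit Types p q : V -> R.

Lemma sublinear0 p : sublinear p -> p 0 = 0.
Proof.
move=> [_ ph].
have := ph 2 0 (ltr0Sn _ 1); have := ph (2^-1) 0; rewrite !scaler0.
by rewrite invr_gt0 ltr0n => /(_ isT); lra.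
Qed.

Lemma sublinearZ p t x : sublinear p -> 0 <= t -> p (t *: x) = t * p x.
Proof.
move=> sp; rewrite le_eqVlt => /predU1P[<-|t0].
  by rewrite scale0r mul0r sublinear0.
apply/eqP; rewrite eq_le; case: (sp) => _ ph; rewrite ph//=.
have := ph t^-1 (t *: x); rewrite invr_gt0 => /(_ t0).
by rewrite scalerA mulVf ?gt_eqF// scale1r mulrC ler_pdivlMr// mulrC.
Qed.

Lemma sublinear_lower p x : sublinear p -> - p (- x) <= p x.
Proof.
by move=> sp; have := sp.1 x (- x); rewrite subrr sublinear0//; lra.
Qed.

Lemma le_infD (A B : set R) c : A !=set0 -> B !=set0 ->
  (forall a b, A a -> B b -> c <= a + b) -> c <= inf A + inf B.
Proof.
move=> A0 B0 cAB; rewrite -lerBlDr; apply: lb_le_inf => // a Aa.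
rewrite lerBlDr addrC -lerBlDr; apply: lb_le_inf => // b Bb.
by rewrite lerBlDr addrC; exact: cAB.
Qed.

Lemma le_infM (A : set R) t c : A !=set0 -> 0 < t ->
  (forall a, A a -> c <= t * a) -> c <= t * inf A.
Proof.
move=> A0 t0 cA; rewrite mulrC -ler_pdivrMr//; apply: lb_le_inf => // a Aa.
by rewrite ler_pdivrMr// mulrC; exact: cA.
Qed.

(* Pushing [p] down along [v] gives a sublinear functional that is odd at [v],
   so that a minimal sublinear functional is linear. *)
Lemma sublinear_push p v : sublinear p ->
  (* The witness is the infimum over [t >= 0] of [p (x + t *: v) - t * p v]: [t = 0] puts it below
     [p], and [t = 1] at [- v] gives [- p v]. *)
  exists q, [/\ sublinear q, forall x, q x <= p x & q (- v) <= - p v].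
Proof.
move=> sp; pose E x := [set p (x + t *: v) - t * p v | t in [set t | 0 <= t]].
have E0 x : E x !=set0 by exists (p (x + 0 *: v) - 0 * p v), 0 => /=.
have lE x : has_lbound (E x).
  exists (- p (- x)) => _ [t /= t0 <-].
  have := sp.1 (x + t *: v) (- x).
  by rewrite addrAC subrr add0r (sublinearZ _ sp)//; lra.
have le x t : 0 <= t -> inf (E x) <= p (x + t *: v) - t * p v.
  by move=> t0; apply: ge_inf => //; exists t.
exists (fun x => inf (E x)); split; [split|..].
- move=> x y; apply: le_infD => // _ _ [t /= t0 <-] [s /= s0 <-].
  apply: le_trans (le _ _ (addr_ge0 t0 s0)) _.
  have := sp.1 (x + t *: v) (y + s *: v).
  by rewrite addrACA -scalerDl; lra.
- move=> s x s0; apply: le_infM => // _ [t /= t0 <-].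
  apply: le_trans (le _ _ (mulr_ge0 (ltW s0) t0)) _.
  have := sp.2 s (x + t *: v) s0.
  by rewrite scalerDr scalerA; lra.
- by move=> x; have := le x 0 (lexx 0); rewrite scale0r addr0 mul0r subr0.
- have := le (- v) 1 ler01; rewrite scale1r addNr mul1r sublinear0//.
  by rewrite sub0r.
Qed.

(** Zorn's lemma for the reversed pointwise order: a chain has its pointwise infimum as bound,
    finite because everything below [p] is at least [- p (- x)], and subadditive because two members
    are comparable. *)
Lemma sublinear_minimal p : sublinear p ->
  exists q, [/\ sublinear q, forall x, q x <= p x &
    forall r, sublinear r -> (forall x, r x <= q x) -> r = q].
Proof.
move=> sp; pose T := {q : V -> R | sublinear q /\ forall x, q x <= p x}.
pose ge (q r : T) := `[< forall x, sval r x <= sval q x >].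
have gerefl (q : T) : ge q q by apply/asboolP.
have getrans (q r s : T) : ge q r -> ge r s -> ge q s.
  move=> /asboolP qr /asboolP rs; apply/asboolP => x.
  exact: le_trans (rs x) (qr x).
have geanti (q r : T) : ge q r -> ge r q -> q = r.
  case: q r => [q qP] [r rP] /asboolP/= qr /asboolP/= rq.
  have qr' : q = r by apply/funext => x; apply/eqP; rewrite eq_le rq qr.
  by subst r; congr exist; exact: Prop_irrelevance.
have gechain (A : set T) : total_on A ge -> exists t, forall s, A s -> ge s t.
  move=> totA; case: (pselect (A !=set0)) => [[s0 As0]|A0]; last first.
    have pP : sublinear p /\ forall x, p x <= p x by [].
    by exists (exist _ p pP) => s As; case: A0; exists s.
  pose E x := [set sval s x | s in A].
  have E0 x : E x !=set0 by exists (sval s0 x), s0.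
  have lE x : has_lbound (E x).
    exists (- p (- x)) => _ [[s [ss sp']] /= As <-].
    by apply: le_trans (sublinear_lower x ss); rewrite lerN2.
  have le x s : A s -> inf (E x) <= sval s x.
    by move=> As; apply: ge_inf => //; exists s.
  have mP : sublinear (fun x => inf (E x)) /\ forall x, inf (E x) <= p x.
    split; last by move=> x; exact: le_trans (le _ _ As0) ((svalP s0).2 x).
    split=> [x y|t x t0].
      apply: le_infD => // _ _ [q Aq <-] [r Ar <-].
      have [/asboolP qr|/asboolP rq] := totA q r Aq Ar.
        apply: le_trans (le _ _ Ar) _; apply: le_trans ((svalP r).1.1 x y) _.
        by rewrite lerD2r.
      apply: le_trans (le _ _ Aq) _; apply: le_trans ((svalP q).1.1 x y) _.
      by rewrite lerD2l.
    apply: le_infM => // _ [q Aq <-].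
    exact: le_trans (le _ _ Aq) ((svalP q).1.2 t x t0).
  by exists (exist _ (fun x => inf (E x)) mP : T) => s As; apply/asboolP => x; exact: le.
have [[q [sq qp]] qmin] := Zorn gerefl getrans geanti gechain.
exists q; split => // r sr rq.
have rP : sublinear r /\ forall x, r x <= p x.
  by split=> // x; exact: le_trans (rq x) (qp x).
have /(_ (asboolT rq)) := qmin (exist _ r rP : T).
by move=> /(congr1 sval).
Qed.

(** A functional [f] minimal below the push of [p] along [v] equals each of its own pushes, so it is
    odd and hence linear; the first push forces [f (- v) <= - p v], that is [p v <= f v]. *)
Theorem hahn_banach p v : sublinear p ->
  exists f : V -> R^o, [/\ linear f, forall x, f x <= p x & f v = p v].
Proof.
move=> sp; have [p' [sp' p'p p'v]] := sublinear_push v sp.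
have [f [sf fp' fmin]] := sublinear_minimal sp'.
have fN x : f (- x) = - f x.
  have [g [sg gf gx]] := sublinear_push x sf.
  have gE := fmin g sg gf; rewrite gE in gx.
  by apply/eqP; rewrite eq_le gx lerNl sublinear_lower.
exists f; split.
- have fZ (a : R) x : f (a *: x) = a * f x.
    have [a0|a0] := leP 0 a; first exact: sublinearZ.
    rewrite -[a]opprK scaleNr fN (sublinearZ _ sf) ?mulNr//.
    by rewrite oppr_ge0 ltW.
  move=> a x y; rewrite -[RHS]/(a * f x + f y) -fZ.
  apply/eqP; rewrite eq_le (sf.1 _ _)/= -lerN2 -fN opprD.
  by rewrite (le_trans (sf.1 _ _))// !fN opprD.
- by move=> x; exact: le_trans (fp' x) (p'p x).
- apply/eqP; rewrite eq_le (le_trans (fp' _) (p'p _))/=.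
  by rewrite -lerN2 -fN (le_trans (fp' _)).
Qed.

End sublinear_functionals.

(** * Norming functionals, separation, and kernels of finitely many functionals *)

Section functionals.
Context (R : realType) (X : normedModType R).

Lemma sublinear_norm : sublinear (fun x : X => `|x|).
Proof.
by split=> [x y|t x t0]; [exact: ler_normD|rewrite normrZ gtr0_norm].
Qed.

Lemma exists_dual (f : X -> R^o) : linear f -> (forall x, f x <= `|x|) ->
  exists F : dual X, (forall x, F x = f x) /\ `|F| <= 1.
Proof.
move=> lf f1.
pose L := GRing.isLinear.Build R X R^o *:%R f lf.
pose g : {linear X -> R^o} := HB.pack f L.
have fn x : `|f x| <= `|x|.
  rewrite ler_norml f1 andbT lerNl.
  by have := f1 (- x); rewrite normrN -[f (- x)]/(g (- x)) linearN.
have cf : continuous f.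
  apply: (@bounded_linear_continuous R X R^o g); apply/linear_boundedP.
  by near=> r => x; apply: (le_trans (fn x)); rewrite ler_peMl//; near: r;
    exact: nbhs_pinfty_ge.
have fP : f \in @dual_pred R X by apply/asboolP.
exists (Dual fP); split => //.
by apply: dual_norm_le => x x1; exact: le_trans (fn x) x1.
Unshelve. all: by end_near. Qed.

Lemma exists_norming (v : X) : exists f : dual X, `|f| <= 1 /\ f v = `|v|.
Proof.
have [f [lf f1 fv]] := hahn_banach v sublinear_norm.
by have [F [Ff F1]] := exists_dual lf f1; exists F; rewrite Ff.
Qed.

Lemma dualZ (f : dual X) a x : f (a *: x) = a * f x :> R.
Proof. by rewrite linearZ. Qed.

Lemma norming_norm1 (v : X) (f : dual X) :
  `|v| = 1 -> `|f| <= 1 -> f v = `|v| -> `|f| = 1.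
Proof.
move=> v1 f1 fv; apply/eqP; rewrite eq_le f1/=.
have := @dual_norm_ub _ _ f v; rewrite fv v1 normr1; exact.
Qed.

(** Hahn-Banach for the distance to [Y], which is sublinear, zero on [Y], and positive at [v]
    because [Y] is closed. *)
Lemma separation (Y : set X) (v : X) : linear_subspace Y -> closed Y ->
  ~ Y v -> exists f : dual X, (forall y, Y y -> f y = 0) /\ f v = 1.
Proof.
move=> [Y0 YD] cY Yv.
have YZ a y : Y y -> Y (a *: y).
  by move=> Yy; have := YD a y 0 Yy Y0; rewrite addr0.
pose E x := [set `|x - y| | y in Y]; pose p x := inf (E x).
have E0 x : E x !=set0 by exists `|x - 0|, 0.
have lE x : has_lbound (E x) by exists 0 => _ [y _ <-].
have ple x y : Y y -> p x <= `|x - y| by move=> Yy; apply: ge_inf => //; exists y.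
have sp : sublinear p.
  split=> [x y|t x t0].
    apply: le_infD => // _ _ [z Yz <-] [w Yw <-].
    have Yzw : Y (z + w) by have := YD 1 z w Yz Yw; rewrite scale1r.
    by rewrite (le_trans (ple _ _ Yzw))// opprD addrACA ler_normD.
  apply: le_infM => // _ [y Yy <-].
  by rewrite (le_trans (ple _ _ (YZ t y Yy)))// -scalerBr normrZ gtr0_norm.
have [f [lf fp fv]] := hahn_banach v sp.
have [F [Ff _]] : exists F : dual X, (forall x, F x = f x) /\ `|F| <= 1.
  apply: exists_dual => // x; apply: le_trans (fp x) _.
  by rewrite (le_trans (ple _ _ Y0))// subr0.
have pv : 0 < p v.
  have : nbhs v (~` Y) by apply: open_nbhs_nbhs; split => //; exact: closed_openC.
  move=> /nbhs_normP[e /= e0 eY]; apply: (@lt_le_trans _ _ e) => //.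
  apply: lb_le_inf => // _ [y Yy <-]; rewrite leNgt; apply/negP => ey.
  by apply: eY Yy; rewrite /ball_/=.
have FY y : Y y -> F y = 0.
  have le0 z : Y z -> F z <= 0.
    move=> Yz; rewrite Ff; apply: le_trans (fp z) _.
    by rewrite (le_trans (ple _ _ Yz))// subrr normr0.
  move=> Yy; apply/eqP; rewrite eq_le le0//=.
  by have := le0 _ (YZ (-1) y Yy); rewrite dualZ mulN1r oppr_le0.
exists ((p v)^-1 *: F); split => [y /FY Fy|].
  by rewrite [LHS](_ : _ = (p v)^-1 * F y)// Fy mulr0.
by rewrite [LHS](_ : _ = (p v)^-1 * F v)// Ff fv mulVf// gt_eqF.
Qed.

Definition ker_seq (F : seq (dual X)) : set X :=
  [set x | forall f, f \in F -> f x = 0].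

Lemma ker_seqP (F : seq (dual X)) f x :
  ker_seq (f :: F) x <-> f x = 0 /\ ker_seq F x.
Proof.
split=> [k|[fx k] g]; last by rewrite inE => /predU1P[->//|/k].
by split=> [|g gF]; apply: k; rewrite inE ?eqxx ?gF ?orbT.
Qed.

Lemma ker_seq_cat (F G : seq (dual X)) x :
  ker_seq (F ++ G) x <-> ker_seq F x /\ ker_seq G x.
Proof.
split=> [k|[kF kG] f]; last by rewrite mem_cat => /orP[/kF|/kG].
by split=> f fF; apply: k; rewrite mem_cat fF ?orbT.
Qed.

Lemma ker_seqZ (F : seq (dual X)) a x : ker_seq F x -> ker_seq F (a *: x).
Proof. by move=> k f /k; rewrite dualZ => ->; rewrite mulr0. Qed.

(** Induction on the number of complementary vectors: if the first one lies outside [Y], adjoin it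
    to [Y] and record a functional that vanishes on [Y] and not on it. *)
Lemma cof_ker_seq (Y : set X) : cof Y -> exists F, ker_seq F `<=` Y.
Proof.
move=> [sY cY [n [v Yv]]]; elim: n Y v sY cY Yv => [|n IH] Y v sY cY Yv.
  exists [::] => x _; have [y Yy [c ->]] := Yv x.
  by rewrite big_ord0 addr0.
have [Y0 YD] := sY.
have YZ a y : Y y -> Y (a *: y).
  by move=> Yy; have := YD a y 0 Yy Y0; rewrite addr0.
have [Yv0|nYv0] := pselect (Y (v ord0)).
  apply: (IH Y (fun i => v (lift ord0 i))) => // x.
  have [y Yy [c ->]] := Yv x.
  exists (c ord0 *: v ord0 + y); first exact: YD.
  exists (fun i => c (lift ord0 i)).
  by rewrite big_ord_recl addrCA addrA.
have [f [fY fv]] := separation sY cY nYv0.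
(* This is the span of [Y] and [v ord0], written as a preimage of [Y] so that it is visibly closed;
   on the kernel of [f] it agrees with [Y]. *)
pose Y' := [set x | Y (x - f x *: v ord0)].
have [|||F FY'] := IH Y' (fun i => v (lift ord0 i)).
- split=> [|a x y Yx Yy]; first by rewrite /Y'/= linear0 scale0r subr0.
  rewrite /Y'/= linearP scalerDl opprD addrACA.
  rewrite -[(a *: f x) *: _]scalerA -scalerBr; exact: YD.
- apply: closed_comp cY => x _; apply: cvgB; first exact: cvg_id.
  by apply: cvgZr_tmp; exact: dual_continuous.
- move=> x; have [y Yy [c ->]] := Yv x.
  exists (y + c ord0 *: v ord0).
    by rewrite /Y'/= linearD/= dualZ fv fY// add0r mulr1 addrK.
  exists (fun i => c (lift ord0 i)).
  by rewrite big_ord_recl addrA.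
exists (f :: F) => x /ker_seqP[fx /FY']; rewrite /Y'/= fx.
by rewrite scale0r subr0.
Qed.

(** Makes weak smallness quantitative. A point near the kernel of [F] is corrected by a multiple of
    a fixed [w] in that kernel with [f w = 1]; if there is no such [w], then [f] already vanishes
    there. *)
Lemma near_ker_seq (F : seq (dual X)) : exists2 M : R, 0 <= M &
  forall z d, 0 <= d -> (forall f, f \in F -> `|f z| <= d) ->
    exists2 y, ker_seq F y & `|z - y| <= M * d.
Proof.
elim: F => [|f F [M M0 FM]].
  by exists 0 => // z d _ _; exists z => //; rewrite subrr normr0 mul0r.
have [[v kv fv]|nv] := pselect (exists2 v, ker_seq F v & f v != 0); last first.
  exists M => // z d d0 zd; have [g gF|y ky yz] := FM z d d0.
    by apply: zd; rewrite inE gF orbT.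
  exists y => //; apply/ker_seqP; split => //.
  by apply/eqP; apply: contra_notT nv => fy; exists y.
pose w := (f v)^-1 *: v.
have kw : ker_seq F w by exact: ker_seqZ.
have fw : f w = 1 by rewrite dualZ mulVf.
exists (M + (1 + `|f| * M) * `|w|).
  by rewrite addr_ge0// mulr_ge0// addr_ge0// mulr_ge0.
move=> z d d0 zd; have [g gF|y ky yz] := FM z d d0.
  by apply: zd; rewrite inE gF orbT.
exists (y - f y *: w).
  apply/ker_seqP; split; first by rewrite linearB/= dualZ fw mulr1 subrr.
  by move=> g gF; rewrite linearB/= dualZ ky// kw// mulr0 subrr.
rewrite opprB addrCA addrC (le_trans (ler_normD _ _))// mulrDl lerD//.
rewrite normrZ mulrAC ler_wpM2r//.
have -> : f y = f z - f (z - y) by rewrite linearB/= subKr.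
rewrite (le_trans (ler_normB _ _))// mulrDl mul1r lerD//; first last.
  by rewrite (le_trans (dual_normP _ _))// -mulrA ler_wpM2l// dual_norm_ge0.
by apply: zd; rewrite inE eqxx.
Qed.

End functionals.

(** * Finite ordinals and nonempty finite Szlenk derivatives *)

Lemma ole_iter_inv b k m :
  ole (iter k osucc ozero) b -> ole b (iter m osucc ozero) -> (k <= m)%N.
Proof.
elim: b k m => [|b IH|I f IH] [|k] m //=.
  by case: m => //= m kb bm; rewrite ltnS; exact: IH bm.
by move=> [i kf] /(_ i) fm; exact: (IH i k.+1 m).
Qed.

Lemma olt_omega_ole_iter a n : olt omega a -> ~ ole a (iter n osucc ozero).
Proof.
elim: a n => [|a IH|I f IH] n //=.
  case: n => [_ []|n] oa an; suff : (n.+1 <= n)%N by rewrite ltnn.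
  exact: (@ole_iter_inv a n.+1 n (oa n.+1) an).
by move=> [i oi] /(_ i); exact: IH.
Qed.

Section szlenk_finite.
Context (R : realType) (Z : normedModType R).
Implicit Types K L : set (dual Z).

Lemma szlenk_derivativeS (e : R) K L : K `<=` L ->
  szlenk_derivative e K `<=` szlenk_derivative e L.
Proof.
move=> KL x [Kx nx]; split; first exact: KL.
move=> [U [[V oV UE] dU] Ux]; apply: nx; exists (K `&` V).
  split; first by exists V.
  apply: le_lt_trans dU; apply: le_ereal_sup => _ [[f g] [/= [Kf Vf] [Kg Vg]] <-].
  by exists (f, g) => //; rewrite UE; split; split => //; exact: KL.
by split => //; move: Ux; rewrite UE => -[].
Qed.

Lemma szlenk_iter_sub (e : R) K a : szlenk_iter e K a `<=` K.
Proof. by elim: a => [|a IH|I f IH] //= x []//; move=> /IH. Qed.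

Local Notation "n %:O" := (iter n osucc ozero) (at level 2).

Lemma szlenk_iter_fin_decr (e : R) K m n : (m <= n)%N ->
  szlenk_iter e K n%:O `<=` szlenk_iter e K m%:O.
Proof.
elim: n => [|n IH]; first by rewrite leqn0 => /eqP->.
by rewrite leq_eqVlt => /predU1P[->//|/IH mn] x [/mn].
Qed.

(** Compares an arbitrary tree [b] with finite stages only, which avoids a general theory of the
    order on [ord]. *)
Lemma szlenk_iter_ole (e : R) K b n : ole n%:O b \/
  exists2 k, (k < n)%N & szlenk_iter e K k%:O `<=` szlenk_iter e K b.
Proof.
elim: b n => [|b IH|I f IH] [|n]; try by left.
- by right; exists 0%N.
- have [nb|[k kn kb]] := IH n; first by left.
  by right; exists k.+1 => //; exact: szlenk_derivativeS.
- have [?|nf] := pselect (ole (n.+1%:O) (osup f)); first by left.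
  (* No [f i] dominates [n.+1], so the derivative at each [f i] contains some stage [k <= n], and
     therefore stage [n]. *)
  right; exists n => // x xn; split; first exact: szlenk_iter_sub xn.
  move=> i _; have [nfi|[k kn]] := IH i n.+1; first by case: nf; exists i.
  by apply; apply: szlenk_iter_fin_decr xn.
Qed.

Lemma szlenk_gt_omega : xolt (Some omega) (szlenk_index Z) ->
  exists2 e : R, 0 < e & forall n, szlenk_iter e (@dual_ball R Z) n%:O !=set0.
Proof.
move=> sz; suff [e eP] : exists e : {posnum R},
    xolt (Some omega) (szlenk_index_at Z e%:num).
  exists e%:num => // n; apply/set0P/negP => /eqP.
  set P := fun a => szlenk_iter e%:num (@dual_ball R Z) a = set0.
  rewrite -/(P n%:O) => Pn; move: eP; rewrite /szlenk_index_at /oleast.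
  case: pselect => [h|[]].
    case: cid => a [Pa aP] /= oa.
    exact: olt_omega_ole_iter oa (aP _ Pn).
  (* [oleast] also yields infinity when there is no least ordinal. This is excluded here: the first
     empty finite stage is least among all ordinals. *)
  have Pb : exists m, `[< P m%:O >] by exists n; apply/asboolP.
  case: (ex_minnP Pb) => m /asboolP Pm mmin; exists m%:O; split => // b bP.
  have [//|[k km kb]] := szlenk_iter_ole e%:num (@dual_ball R Z) b m.
  have : (m <= k)%N.
    by apply: mmin; apply/asboolP; rewrite /P -subset0 -bP.
  by rewrite leqNgt km.
move: sz; rewrite /szlenk_index /xosup; case: pselect => [[e eN] _|_ /=].
  by exists e; rewrite eN.
move=> [e oe]; exists e; move: oe; case: szlenk_index_at => //=.
Qed.

End szlenk_finite.

(** * Weak-star neighbourhoods and one step down the derivatives *)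

Section weak_star_step.
Context (R : realType).

Lemma weak_star_eval_continuous (Z : normedModType R) (g : Z) :
  continuous (fun psi : weak_star Z => (psi : dual Z) g).
Proof.
move=> psi.
pose j : weak_star Z -> {ptws Z -> R^o} := fun psi => (psi : dual Z).
have cj : continuous j := @initial_continuous (dual Z) {ptws Z -> R^o} j.
exact: (@continuous_comp _ _ _ j (fun h : {ptws Z -> R^o} => h g) psi (cj psi)
  (@proj_continuous Z (fun=> R^o) g (j psi))).
Qed.

Lemma weak_star_nbhs (Z : normedModType R) (phi : dual Z) (G : seq Z) (d : R) :
  0 < d -> exists2 V : set (dual Z), open (V : set (weak_star Z)) &
    V phi /\ forall psi, V psi -> forall g, g \in G -> `|psi g - phi g| < d.
Proof.
move=> d0; elim: G => [|g G [V oV [Vphi VG]]].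
  by exists setT => //; exact: openT.
exists (V `&` (fun psi : weak_star Z => (psi : dual Z) g) @^-1`
               ball (phi g : R^o) d).
  apply: openI => //; apply: open_comp; last exact: ball_open.
  by move=> psi _; exact: weak_star_eval_continuous.
split; first by split => //; exact: ballxx.
move=> psi [/VG Vpsi psig] h; rewrite inE => /predU1P[->|/Vpsi//].
by rewrite distrC.
Qed.

Lemma szlenk_derivative_far (Z : normedModType R) (e d : R) (K : set (dual Z))
    (phi : dual Z) (G : seq Z) :
  0 < e -> 0 < d -> szlenk_derivative e K phi -> exists psi,
  [/\ K psi, forall g, g \in G -> `|psi g - phi g| < d & e / 4 <= `|psi - phi|].
Proof.
move=> e0 d0 [Kphi nphi]; have [V oV [Vphi VG]] := weak_star_nbhs phi G d0.
apply: contrapT => nopsi; apply: nphi; exists (K `&` V) => //; split.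
  by exists V.
(* If the whole neighbourhood were within [e / 4] of [phi], its diameter would be at most [e / 2],
   strictly below [e], and [phi] would have been removed. *)
apply: (@le_lt_trans _ _ (e / 2)%:E); last by rewrite lte_fin; lra.
apply: ge_ereal_sup => _ [[f g] [/= [Kf Vf] [Kg Vg]] <-].
have near h : K h -> V h -> `|h - phi| < e / 4.
  move=> Kh Vh; rewrite ltNge; apply/negP => eh; apply: nopsi.
  by exists h; split => // k; exact: VG.
rewrite lee_fin; have := ler_distD phi f g.
by have := near f Kf Vf; have := near g Kg Vg; rewrite (distrC phi); lra.
Qed.

Definition represents (X : normedModType R) (phi : dual (dual X)) (x : X) :=
  forall f, phi f = f x.

Lemma represents_dist (X : normedModType R) (phi psi : dual (dual X)) x y :
  represents phi x -> represents psi y -> `|phi - psi| <= `|x - y|.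
Proof.
move=> px py; apply: dual_norm_le => f f1.
rewrite [(phi - psi) f](_ : _ = phi f - psi f)// px py -linearB.
by rewrite (le_trans (dual_normP _ _))// ler_piMl.
Qed.

Lemma represents_norm (X : normedModType R) (phi : dual (dual X)) x :
  represents phi x -> `|x| <= `|phi|.
Proof.
move=> px; have [f [f1 <-]] := exists_norming x; rewrite -px.
by rewrite (le_trans (ler_norm _))// (dual_norm_ub phi f1).
Qed.

(** A far point [y] of [K] differs from [u] by a vector on which [F] is small, hence close to the
    kernel of [F]; [z] is the normalized kernel part and [c] its norm. *)
Lemma szlenk_derivative_step (X : normedModType R) (e eta : R)
    (K : set (dual (dual X))) (phi : dual (dual X)) (u : X) (F : seq (dual X)) :
  reflexive_space X -> 0 < e -> 0 < eta ->
  szlenk_derivative e K phi -> represents phi u ->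
  exists psi y z c, [/\ K psi, represents psi y, `|z| = 1 /\ ker_seq F z,
    e / 8 <= c & `|y - u - c *: z| <= eta].
Proof.
move=> rX e0 eta0 Kphi pu; have [M M0 FM] := near_ker_seq F.
(* The bound [eta] controls the perturbation, and [e / 8] leaves the kernel part a norm of at least
   [e / 4 - e / 8]. Dividing by [M + 1] absorbs the constant [M] even if it is zero. *)
pose m := Num.min eta (e / 8).
have m0 : 0 < m by rewrite lt_min eta0 divr_gt0.
have M1 : 0 < M + 1 by rewrite ltr_wpDl.
have d0 : 0 < m / (M + 1) by rewrite divr_gt0.
have [psi [Kpsi Fpsi dpsi]] := szlenk_derivative_far F e0 d0 Kphi.
have [y py] := rX psi.
have yu : e / 4 <= `|y - u| by exact: le_trans dpsi (represents_dist py pu).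
have [f fF|z0 kz0] := FM (y - u) _ (ltW d0).
  by rewrite linearB /= -py -pu ltW// Fpsi.
have Mm : M * (m / (M + 1)) <= m.
  by rewrite mulrCA ler_piMr ?(ltW m0)// ler_pdivrMr// mul1r ler_wpDr.
move=> /le_trans/(_ Mm); rewrite le_min => /andP[zeta ze].
have z0n : e / 8 <= `|z0|.
  have := ler_normD (y - u - z0) z0; rewrite subrK; lra.
have z0gt : 0 < `|z0| by apply: lt_le_trans z0n; rewrite divr_gt0.
exists psi, y, (`|z0|^-1 *: z0), `|z0|; split => //.
- by split; [rewrite normrZ normfV normr_id mulVf// gt_eqF|exact: ker_seqZ].
- by rewrite scalerA mulfV ?gt_eqF// scale1r.
Qed.

End weak_star_step.

(** * Combinations with bounded coefficients and their norms *)

Section cubes.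
Context (R : realType) (X : normedModType R).
Implicit Types (r : R) (s t : seq X) (x v w : X).

Fixpoint cube r s : set X :=
  if s is x :: s' then
    [set v | exists2 a, `|a| <= r & exists2 w, cube r s' w & v = a *: x + w]
  else [set 0].

Lemma cubeP r s v : 0 <= r -> cube r s v <-> exists2 a : nat -> R,
  (forall i, `|a i| <= r) & v = \sum_(i < size s) a i *: s`_i.
Proof.
move=> r0; elim: s v => [|x s IH] v /=.
  split=> [->|[a _ ->]]; last by rewrite big_ord0.
  by exists (fun=> 0) => [i|]; rewrite ?big_ord0 ?normr0.
split=> [[c cr [w /IH[a ar ->] ->]]|[a ar ->]].
  exists (fun i => if i is j.+1 then a j else c); first by case.
  by rewrite big_ord_recl.
rewrite big_ord_recl/=; exists (a 0%N) => //; eexists; last reflexivity.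
by apply/IH; exists (fun i => a i.+1).
Qed.

Lemma cube_cat r s t v w : cube r s v -> cube r t w -> cube r (s ++ t) (v + w).
Proof.
elim: s v => [|x s IH] v /=; first by move=> ->; rewrite add0r.
move=> [a ar [v' sv' ->]] tw; exists a => //; exists (v' + w); first exact: IH.
by rewrite addrA.
Qed.

Lemma cube_rcons r s x v : cube r (rcons s x) v ->
  exists2 w, cube r s w & exists2 a, `|a| <= r & v = w + a *: x.
Proof.
elim: s v => [|y s IH] v /=.
  by move=> [a ar [_ -> ->]]; exists 0 => //; exists a => //; rewrite addrC.
move=> [a ar [v' /IH[w sw [b br ->]] ->]].
exists (a *: y + w); first by exists a => //; exists w.
by exists b => //; rewrite addrA.
Qed.

Lemma cubeZ r c s v : cube r s v -> cube (`|c| * r) s (c *: v).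
Proof.
elim: s v => [|x s IH] v /=; first by move=> ->; rewrite scaler0.
move=> [a ar [w sw ->]]; exists (c * a); first by rewrite normrM ler_wpM2l.
by exists (c *: w); [exact: IH|rewrite scalerDr scalerA].
Qed.

(* A convex function on a cube is bounded by its values at the vertices. *)
Lemma cube_vertices s M u :
  (forall e : nat -> bool, `|u + \sum_(i < size s) (-1) ^+ e i *: s`_i| <= M) ->
  forall v, cube 1 s v -> `|u + v| <= M.
Proof.
elim: s u => [|x s IH] u sM v /=.
  by move=> ->; have := sM (fun=> false); rewrite big_ord0.
move=> [a a1 [w sw ->]].
have xM (b : bool) : `|u + (-1) ^+ b *: x + w| <= M.
  apply: IH => // e; have := sM (fun i => if i is j.+1 then e j else b).
  by rewrite big_ord_recl/= addrA.
have -> : u + (a *: x + w) = ((1 + a) / 2) *: (u + (-1) ^+ false *: x + w) +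
                             ((1 - a) / 2) *: (u + (-1) ^+ true *: x + w).
  rewrite !scalerDr !scalerA expr0 expr1 mulr1 mulrN1 addrACA -scalerDl.
  rewrite [in RHS]addrACA -!scalerDl.
  rewrite -[(1 + a + (1 - a)) *: _]/((1 + a + (1 - a)) / 2).
  have -> : (1 + a + (1 - a)) / 2 = 1 by field.
  have -> : (1 + a) / 2 - (1 - a) / 2 = a by field.
  by rewrite !scale1r addrA.
move: a1; rewrite ler_norml => /andP[a0 a1].
have p0 : 0 <= (1 + a) / 2 by lra.
have m0 : 0 <= (1 - a) / 2 by lra.
rewrite (le_trans (ler_normD _ _))// (normrZ ((1 + a) / 2)) (ger0_norm p0).
rewrite (normrZ ((1 - a) / 2)) (ger0_norm m0).
have := ler_wpM2l p0 (xM false); have := ler_wpM2l m0 (xM true); lra.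
Qed.

Definition upper_linfty (M : R) s := forall v, cube 1 s v -> `|v| <= M.

Lemma upper_linfty_cube M r s v : 0 < r -> upper_linfty M s -> cube r s v ->
  `|v| <= r * M.
Proof.
move=> r0 sM /(cubeZ r^-1); rewrite normfV gtr0_norm// mulVf ?gt_eqF// => /sM.
by rewrite normrZ normfV gtr0_norm// ler_pdivrMl.
Qed.

(* With [a] attained at a unit vector [x], flipping the sign of [x] gives
   [2 a x] as a difference of two vectors of the cube. *)
Lemma upper_linfty_lower d r s v i a : 0 < r ->
  (forall x, x \in s -> `|x| = 1) -> upper_linfty (1 + d) s ->
  (forall j, `|a j| <= r) -> (i < size s)%N -> `|a i| = r ->
  v = \sum_(j < size s) a j *: s`_j -> (1 - d) * r <= `|v|.
Proof.
move=> r0 s1 sd ar si air vE.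
pose v' := \sum_(j < size s) (if j == i :> nat then - a j else a j) *: s`_j.
have v'r : `|v'| <= r * (1 + d).
  apply: (upper_linfty_cube r0 sd); apply/cubeP; first exact: ltW.
  exists (fun j => if j == i :> nat then - a j else a j) => // j.
  by case: ifP; rewrite ?normrN.
have : `|v - v'| = 2 * r.
  rewrite vE /v' -sumrB (bigD1 (Ordinal si))//= eqxx big1 ?addr0.
    rewrite scaleNr opprK -mulr2n normrMn normrZ air s1 ?mem_nth//.
    by rewrite mulr1 mulr_natl.
  by move=> j /negP; rewrite -val_eqE/= => /negP/negbTE->; rewrite subrr.
have := ler_normB v v'; lra.
Qed.

Lemma unconditional_upper C L c s : 0 < c -> unconditional C s ->
  (exists2 a : nat -> R, forall i, c <= a i &
    `|\sum_(i < size s) a i *: s`_i| <= L) ->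
  0 <= C -> upper_linfty (c^-1 * (C * L)) s.
Proof.
move=> c0 sC [a ca sL] C0 v /cubeP[//|b b1 ->].
pose z := mkseq (fun i => a i *: s`_i) (size s).
have a0 i : 0 < a i by exact: lt_le_trans (ca i).
have zL : upper_linfty (C * L) z.
  move=> w zw; rewrite -[w]add0r; apply: cube_vertices zw => e; rewrite add0r.
  rewrite size_mkseq (le_trans _ (ler_wpM2l C0 sL))// -[leLHS]/(`|_|).
  apply: le_trans (sC a e); rewrite le_eqVlt; apply/orP; left; apply/eqP.
  by congr `|_|; apply: eq_bigr => i _; rewrite nth_mkseq// scalerA.
apply: (upper_linfty_cube _ zL); first by rewrite invr_gt0.
apply/cubeP; first by rewrite invr_ge0 ltW.
exists (fun i => b i / a i) => [i|].
  rewrite normrM normfV (gtr0_norm (a0 i)) -[leRHS]mul1r.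
  by rewrite ler_pM ?b1 ?lef_pV2 ?posrE// invr_ge0 ltW.
rewrite size_mkseq; apply: eq_bigr => i _.
by rewrite nth_mkseq// scalerA divfK// gt_eqF.
Qed.

End cubes.

(** * The game on functionals and unit vectors, and its first upper bound *)

Section vector_game.
Context (R : realType) (X : normedModType R).
Implicit Types (s t w : seq X) (P Q : seq X -> Prop).

(* The second player answers a finite set of functionals by a unit vector of
   their common kernel; these kernels are cofinal in [cof X] by [cof_ker_seq]. *)
Fixpoint vector_wins n P s : Prop :=
  if n is m.+1 then
    forall F, exists x, [/\ ker_seq F x, `|x| = 1 & vector_wins m P (rcons s x)]
  else P s.

Lemma vector_wins_mono n P Q s : (forall t, P t -> Q t) ->
  vector_wins n P s -> vector_wins n Q s.
Proof.
move=> PQ; elim: n s => [|n IH] s /=; first exact: PQ.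
by move=> W F; have [x [Fx x1 /IH]] := W F; exists x.
Qed.

Lemma vector_wins_size n P s : vector_wins n P s ->
  vector_wins n (fun t => P t /\ size t = (size s + n)%N) s.
Proof.
elim: n s => [|n IH] s /=; first by rewrite addn0.
move=> W F; have [x [Fx x1 /IH]] := W F.
by rewrite size_rcons addSnnS; exists x.
Qed.

(** Both games are played at once: the second player answers [F] enlarged by functionals [G] whose
    kernel lies in the prescribed subspace. *)
Lemma vector_wins_unconditional C n P s : unconditional_game C n s ->
  vector_wins n P s -> vector_wins n (fun t => P t /\ unconditional C t) s.
Proof.
elim: n s => [|n IH] s //= [Y cY YU] W F.
have [G GY] := cof_ker_seq cY.
have [x [/ker_seq_cat[Fx /GY Yx] x1 Wx]] := W (F ++ G).
by exists x; split => //; apply: IH => //; exact: YU.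
Qed.

(** Invariant of the walk from [u0] to the current [u]: their difference is the combination of the
    vectors played, up to [eta] per move. Both ends lie in the unit ball, whence the bound 2 plus
    the error. *)
Lemma vector_wins_szlenk (e eta : R) n s (c : nat -> R) (u0 u : X) phi :
  reflexive_space X -> 0 < e -> 0 < eta -> `|u0| <= 1 ->
  szlenk_iter e (@dual_ball R (dual X)) (iter n osucc ozero) phi ->
  represents phi u -> (forall i, e / 8 <= c i) ->
  `|u - u0 - \sum_(i < size s) c i *: s`_i| <= (size s)%:R * eta ->
  vector_wins n (fun t => exists2 c : nat -> R, forall i, e / 8 <= c i &
    `|\sum_(i < size t) c i *: t`_i| <= 2 + (size t)%:R * eta) s.
Proof.
move=> rX e0 eta0 u01.
elim: n s c u phi => [|n IH] s c u phi /= sphi pu ce us.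
  exists c => //; set S := \sum_(_ < _) _ in us *.
  have u1 : `|u| <= 1.
    exact: le_trans (represents_norm pu) sphi.
  rewrite -[S](subKr (u - u0)) (le_trans (ler_normB _ _))// lerD//.
  by rewrite (le_trans (ler_normB _ _))// [leRHS](_ : _ = 1 + 1)// lerD.
move=> F.
have [psi [y [z [b [Kpsi py [z1 Fz] eb yz]]]]] :=
  szlenk_derivative_step F rX e0 eta0 sphi pu.
exists z; split => //.
(* Index [size s] receives the new coefficient; the later ones are never summed, and the value [b]
   keeps the lower bound valid for every index. *)
apply: (IH _ (fun i => if (i < size s)%N then c i else b) y psi) => //.
  by move=> i; case: ifP.
rewrite size_rcons big_ord_recr/= ltnn nth_rcons ltnn eqxx.
have -> : \sum_(i < size s) (if (i < size s)%N then c i else b) *: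
      (rcons s z)`_i = \sum_(i < size s) c i *: s`_i.
  by apply: eq_bigr => i _; rewrite ltn_ord nth_rcons ltn_ord.
set S := \sum_(_ < _) _ in us *.
have -> : y - u0 - (S + b *: z) = (u - u0 - S) + (y - u - b *: z).
  by rewrite [RHS]addrACA -opprD; congr (_ - _); rewrite [RHS]addrC subrKA.
rewrite (le_trans (ler_normD _ _))// -natr1 mulrDl mul1r.
exact: lerD.
Qed.

Lemma vector_wins_upper : reflexive_space X ->
  unconditional_asymptotic_structure X ->
  xolt (Some omega) (szlenk_index (dual X)) ->
  exists M : R, forall n, vector_wins n (upper_linfty M) [::].
Proof.
move=> rX [C C1 UC] /szlenk_gt_omega[e e0 sz].
have C0 : 0 < C by exact: lt_le_trans C1.
have e8 : 0 < e / 8 by rewrite divr_gt0.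
exists ((e / 8)^-1 * (C * 3)) => n; have [phi sphi] := sz n; have [u pu] := rX phi.
have u1 : `|u| <= 1.
  apply: le_trans (represents_norm pu) _; exact: szlenk_iter_sub sphi.
(* With this perturbation per move, [n] moves cost at most 1 in total, so 2 becomes the 3 in the
   constant. *)
have n0 : 0 < n.+1%:R^-1 :> R by rewrite invr_gt0 ltr0n.
have W := @vector_wins_szlenk e n.+1%:R^-1 n [::] (fun=> e / 8) u u phi
  rX e0 n0 u1 sphi pu (fun=> lexx _).
rewrite big_ord0 !subrr normr0 mul0r in W; have {}W := W (lexx _).
have {}W := vector_wins_unconditional (UC n) (vector_wins_size W).
apply: vector_wins_mono W => t [[[c ce tc] tn] tC].
apply: unconditional_upper (ltW C0) => //; exists c => //.
apply: le_trans tc _; rewrite (_ : 3 = 2 + 1 :> R); last by ring.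
by rewrite lerD2l tn add0n ler_pdivrMr ?ltr0n// mul1r ler_nat.
Qed.

End vector_game.

(** * James' blocking argument on strategies *)

Section james_distortion.
Context (R : realType) (X : normedModType R).
Implicit Types (s t w : seq X) (P Q : seq X -> Prop).

Lemma cubeS (r r' : R) s : r <= r' -> cube r s `<=` cube r' s.
Proof.
move=> rr'; elim: s => [|x s IH] v //= [a ar [w /IH sw ->]].
by exists a; [exact: le_trans rr'|exists w].
Qed.

Lemma cube_ker_seq (r : R) F s v :
  (forall x, x \in s -> ker_seq F x) -> cube r s v -> ker_seq F v.
Proof.
elim: s v => [|x s IH] v sF /=; first by move=> -> f _; rewrite linear0.
move=> [a _ [w /IH sw ->]] f fF; rewrite linearD/= dualZ.
rewrite (sF x (mem_head _ _))// mulr0 add0r sw// => y ys.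
by apply: sF; rewrite inE ys orbT.
Qed.

Lemma upper_linftyS (M M' : R) s : M <= M' -> upper_linfty M s -> upper_linfty M' s.
Proof. by move=> MM' sM v /sM vM; exact: le_trans MM'. Qed.

(** The winning strategy for [P] is run against a first player who adds to [F] the functionals that
    refute [Q]. After [k] rounds the new block fails [Q], while [N] winning rounds for [P]
    remain. *)
Lemma vector_wins_block k N P Q F s w :
  (forall x, x \in w -> ker_seq F x) ->
  vector_wins (k + N) P (s ++ w) -> ~ vector_wins k Q w ->
  exists w', [/\ forall x, x \in w' -> ker_seq F x,
    vector_wins N P (s ++ w') & ~ Q w'].
Proof.
elim: k w => [|k IH] w wF /= W nW; first by exists w.
have /existsNP[G nG] := nW.
have [x [/ker_seq_cat[Fx Gx] x1 Wx]] := W (F ++ G).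
apply: (IH (rcons w x)); last by move=> Wk; apply: nG; exists x.
  by move=> y; rewrite mem_rcons inE => /predU1P[->|/wF].
by rewrite -rcons_cat.
Qed.

(* If the second player could not force [m] vectors to be [upper_linfty t], the
   first player could force [m] successive blocks each carrying a vector of its
   unit cube of norm [> t]; normalizing these vectors divides the upper bound
   [t * t] by [t], a contradiction. *)
Lemma vector_wins_upper_sqrt (t : R) : 0 < t ->
  (forall n, vector_wins n (upper_linfty (t * t)) ([::] : seq X)) ->
  forall n, vector_wins n (upper_linfty t) ([::] : seq X).
Proof.
move=> t0 W m; apply: contrapT => nW.
(* Here [s] collects all vectors of the long game and [y] the normalized block vectors. Each of
   these has coefficients at most [t^-1] on its own block, so the cube of [y] lies in the
   [t^-1]-cube of [s]. *)
suff wins j s y : vector_wins (j * m) (upper_linfty (t * t)) s ->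
    (forall v, cube 1 y v -> cube t^-1 s v) -> vector_wins j (upper_linfty t) y.
  by apply: nW; apply: (wins m [::]) => //; exact: W.
elim: j s y => [|j IH] s y.
  move=> /= Ws ys v /ys sv; rewrite -[leRHS](mulKf (lt0r_neq0 t0)).
  by apply: (upper_linfty_cube _ Ws sv); rewrite invr_gt0.
rewrite mulSn -{1}[s]cats0 => Ws ys F.
have w0 : forall x : X, x \in [::] -> ker_seq F x by [].
have [w [wF Ww]] := vector_wins_block w0 Ws nW.
move=> /existsNP[z /not_implyP[wz /negP]]; rewrite -ltNge => tz.
have z0 : 0 < `|z| by exact: lt_trans tz.
exists (`|z|^-1 *: z); split.
- exact/ker_seqZ/(cube_ker_seq wF wz).
- by rewrite normrZ normfV normr_id mulVf// gt_eqF.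
apply: (IH (s ++ w)) => // v /cube_rcons[v' /ys sv' [a a1 ->]].
apply: cube_cat => //; rewrite scalerA.
apply: cubeS (cubeZ (a / `|z|) wz); rewrite mulr1 normrM normfV normr_id.
rewrite -[leRHS]mul1r ler_pM// ?invr_ge0//.
by rewrite lef_pV2 ?posrE// ltW.
Qed.

Lemma vector_wins_almost_isometric (M d : R) : 0 < d ->
  (forall n, vector_wins n (upper_linfty M) ([::] : seq X)) ->
  forall n, vector_wins n (upper_linfty (1 + d)) ([::] : seq X).
Proof.
move=> d0 W; have d1 : 0 < 1 + d by rewrite addr_gt0.
(* Bernoulli's inequality gives such an [r]; each of the [r] square roots then halves the exponent,
   down to 1. *)
have [r Mr] : exists r, M <= (1 + d) ^+ (2 ^ r)%N.
  have [r Mr] : exists r : nat, M / d <= r%:R.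
    by exists (Num.truncn (M / d)).+1; rewrite ltW// truncnS_gt.
  have bernoulli k : k%:R * d <= (1 + d) ^+ k.
    elim: k => [|k IHk]; first by rewrite mul0r.
    rewrite exprS mulrDl mul1r -natr1 mulrDl mul1r lerD//.
    by rewrite ler_peMr ?exprn_ege1 ?lerDl ?(ltW d0).
  exists r; apply: le_trans (bernoulli _).
  rewrite -ler_pdivrMr// (le_trans Mr)// ler_nat.
  exact/ltnW/ltn_expl.
have {}W n := vector_wins_mono (fun s => @upper_linftyS _ _ s Mr) (W n).
elim: r W {Mr} => [|r IH] W; first by rewrite expn0 expr1 in W.
apply: IH; apply: vector_wins_upper_sqrt; first by rewrite exprn_gt0.
by move=> n; have := W n; rewrite -exprD addnn -mul2n expnS.
Qed.

End james_distortion.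

(** * Finite nets and Mazur's extension of basic sequences *)

Section basic_sequences.
Context (R : realType) (X : normedModType R).

Lemma interval_net (K d : R) : 0 < d -> exists g : seq R,
  forall a, `|a| <= K -> exists2 b, b \in g & `|a - b| <= d.
Proof.
move=> d0; exists [seq - K + j%:R * d | j <- iota 0 (Num.truncn (2 * K / d)).+1].
move=> a; rewrite ler_norml => /andP[Ka aK].
have t0 : 0 <= (a + K) / d by rewrite divr_ge0 ?(ltW d0)//; lra.
exists (- K + (Num.truncn ((a + K) / d))%:R * d).
  apply/mapP; exists (Num.truncn ((a + K) / d)) => //.
  rewrite mem_iota/= add0n ltnS; apply: le_truncn.
  by rewrite ler_pM2r ?invr_gt0//; lra.
move: (truncn_itv t0); set n := Num.truncn _ => /andP[].
rewrite -(natr1 n) ler_pdivlMr// ltr_pdivrMr// mulrDl mul1r => tl tu.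
by rewrite ler_norml; apply/andP; split; lra.
Qed.

Lemma cube_net (K d : R) (s : seq X) : 0 < d -> exists N : seq X,
  forall v, cube K s v -> exists2 w, w \in N & `|v - w| <= d.
Proof.
elim: s d => [|x s IH] d d0 /=.
  by exists [:: 0] => v ->; exists 0; rewrite ?mem_head// subrr normr0 ltW.
have [N NP] := IH (d / 2) (divr_gt0 d0 (ltr0Sn _ 1)).
have x1 : 0 < `|x| + 1 by rewrite ltr_wpDl.
have dx : 0 < d / 2 / (`|x| + 1) by rewrite !divr_gt0.
have [g gP] := interval_net K dx.
exists [seq b *: x + w | b <- g, w <- N].
move=> _ [a /gP[b bg ab] [v /NP[w wN vw] ->]].
exists (b *: x + w); first by apply/allpairsP; exists (b, w).
rewrite opprD addrACA -scalerBl (le_trans (ler_normD _ _))// (splitr d) lerD//.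
rewrite normrZ (@le_trans _ _ (`|a - b| * (`|x| + 1)))//.
  by rewrite ler_wpM2l// lerDl.
by rewrite -ler_pdivlMr.
Qed.

(* Mazur: norming functionals of a finite net of the cube almost norm it. *)
Lemma cube_norming (K d : R) (s : seq X) : 0 < d -> exists F : seq (dual X),
  forall v y, cube K s v -> ker_seq F y -> `|v| <= `|v + y| + d.
Proof.
move=> d0; have [N NP] := cube_net K s (divr_gt0 d0 (ltr0Sn _ 1)).
have [nf nfP] := choice (@exists_norming R X).
exists (map nf N) => v y /NP[w wN vw] Fy.
have [f1 fw] := nfP w.
have fy : nf w y = 0 by apply: Fy; exact: map_f.
have le1 x : nf w x <= `|x|.
  rewrite (le_trans (ler_norm _))// (le_trans (dual_normP _ _))//.
  by rewrite ler_piMl.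
have := le1 (v + y); have := le1 (w - v); rewrite linearB linearD/= fy fw.
have := ler_normD (v - w) w; rewrite subrK (distrC w); lra.
Qed.

(** The coefficient bound places every normalized combination in one fixed cube, so finitely many
    functionals suffice. The tolerance [1 - q^-1] turns their estimate for unit vectors into the
    factor [q]. *)
Lemma basic_extension (K q : R) (l : seq X) : 1 < q ->
  (forall (a : nat -> R) m, (m < size l)%N ->
    `|a m| <= K * `|\sum_(i < size l) a i *: l`_i|) ->
  exists F : seq (dual X), forall (a : nat -> R) y, ker_seq F y ->
    `|\sum_(i < size l) a i *: l`_i| <= q * `|\sum_(i < size l) a i *: l`_i + y|.
Proof.
move=> q1 lK; have q0 : 0 < q by exact: lt_trans q1.
have d0 : 0 < 1 - q^-1 by rewrite subr_gt0 invf_lt1.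
have [F FP] := cube_norming `|K| l d0; exists F => a y Fy.
set v := \sum_(_ < _) _.
have [->|v0] := eqVneq v 0; first by rewrite normr0 mulr_ge0// ltW.
have vgt : 0 < `|v| by rewrite normr_gt0.
have cv : cube `|K| l (`|v|^-1 *: v).
  apply/cubeP => //.
  (* The bound in [cubeP] is asked for all indices, so those past the end are set to zero. *)
  exists (fun i => if (i < size l)%N then `|v|^-1 * a i else 0) => [i|].
    case: ifP => il; last by rewrite normr0.
    rewrite normrM normfV normr_id ler_pdivrMl// mulrC.
    by rewrite (le_trans (lK a i il))// ler_wpM2r// ler_norm.
  by rewrite scaler_sumr; apply: eq_bigr => i _; rewrite ltn_ord scalerA.
have := FP _ (`|v|^-1 *: y) cv (ker_seqZ _ Fy).
rewrite -scalerDr !normrZ normfV normr_id mulVf ?gt_eqF// => h.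
have {}h : q^-1 <= `|v|^-1 * `|v + y| by lra.
by rewrite -ler_pdivrMl// mulrC -ler_pdivlMl.
Qed.

End basic_sequences.

(** * Construction of the tree vectors one by one along the ordering *)

Lemma seq_dependent_choice (T : Type) (x0 : T) (P : seq T -> Prop) :
  P [::] -> (forall l, P l -> exists x, P (rcons l x)) ->
  exists f : nat -> T, forall N, P (mkseq f N).
Proof.
move=> P0 PS; have /choice[g gP] : forall l, exists x, P l -> P (rcons l x).
  move=> l; have [/PS[x Px]|nP] := pselect (P l); first by exists x.
  by exists x0.
pose L N := iter N (fun l => rcons l (g l)) [::].
exists (fun N => g (L N)) => N.
have -> : mkseq (fun N => g (L N)) N = L N.
  by elim: N => // N IH; rewrite mkseqS IH.
by elim: N => //= N IH; exact: gP.
Qed.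

Section tree_construction.
(** A node is the increasing list of its elements; [T] selects the nodes, [p] is their position in
    the ordering, [nf] chooses norming functionals, and [U] is the property to be won on every full
    branch. *)
Context (R : realType) (X : normedModType R) (U : seq X -> Prop) (e : R).
Context (nf : X -> dual X) (n : nat) (T : pred (seq nat)) (p : seq nat -> nat).
Context (e0 : 0 < e) (T_size : forall b, T b -> (size b <= n)%N)
  (T_belast : forall b k, T (rcons b k) -> T b)
  (p_lt : forall b k, T (rcons b k) -> (p b < p (rcons b k))%N)
  (p_inj : forall b c, T b -> T c -> p b = p c -> b = c)
  (p_surj : forall i, exists2 b, T b & p b = i)
  (winsU : vector_wins n.+1 U [::]).

(** The empty node is included, so a node of size [n] takes [n.+1] rounds of the game. *)
Definition branch (l : seq X) (b : seq nat) :=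
  [seq l`_(p (take i b)) | i <- iota 0 (size b).+1].

Lemma p_take b i : T b -> (p (take i b) <= p b)%N.
Proof.
elim/last_ind: b => [|b k IH] //= Tb.
have [ib|bi] := leqP i (size b).
  rewrite -cats1 takel_cat// cats1 (leq_trans (IH (T_belast Tb)))//.
  exact/ltnW/p_lt.
by rewrite take_oversize// size_rcons.
Qed.

Lemma eq_branch (l l' : seq X) b : T b ->
  (forall i, (i <= p b)%N -> l`_i = l'`_i) -> branch l b = branch l' b.
Proof. by move=> Tb ll'; apply: eq_map => i; apply: ll'; exact: p_take. Qed.

Lemma branch_rcons (l : seq X) b k :
  branch l (rcons b k) = rcons (branch l b) l`_(p (rcons b k)).
Proof.
rewrite /branch size_rcons -(addn1 (size b).+1) iotaD map_cat cats1 add0n.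
rewrite take_oversize ?size_rcons//; congr (rcons _ _); apply/eq_in_map => i.
by rewrite mem_iota add0n => /andP[_ ib]; rewrite -cats1 takel_cat.
Qed.

(* Increasing weights with values in [1, 1 + e]. *)
Definition weight (i : nat) : R := 1 + e * (1 - i.+1%:R^-1).

Lemma weight_ge1 i : 1 <= weight i.
Proof.
by rewrite lerDl mulr_ge0 ?(ltW e0)// subr_ge0 invf_le1 ?ler1n ?ltr0n.
Qed.

Lemma weight_gt0 i : 0 < weight i.
Proof. exact: lt_le_trans (weight_ge1 i). Qed.

Lemma weight_le i : weight i <= 1 + e.
Proof. by rewrite lerD2l ler_piMr ?(ltW e0)// gerBl invr_ge0. Qed.

Lemma weight_lt i : weight i < weight i.+1.
Proof.
by rewrite ltrD2l ltr_pM2l// ltrD2l ltrN2 ltf_pV2 ?posrE ?ltr0n// ltr_nat.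
Qed.

Definition psum (l : seq X) (a : nat -> R) i := \sum_(m < i) a m *: l`_m.

Lemma psumS l a i : psum l a i.+1 = psum l a i + a i *: l`_i.
Proof. by rewrite /psum big_ord_recr. Qed.

(** The third clause telescopes to a basis constant [weight j / weight i], which stays below [1 + e]
    at every length. The fourth keeps the remaining rounds winnable at each node already placed, so
    that its children can be answered later. *)
Definition tree_inv (l : seq X) :=
  [/\ forall i, (i < size l)%N -> `|l`_i| = 1,
      forall j i, (j < i)%N -> (i < size l)%N -> nf l`_j l`_i = 0,
      forall i a, (i < size l)%N ->
        weight i * `|psum l a i| <= weight i.+1 * `|psum l a i.+1| &
      forall b, T b -> (p b < size l)%N ->
        vector_wins (n - size b) U (branch l b)].

Lemma tree_inv_psum l a i j : tree_inv l -> (i <= j <= size l)%N ->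
  weight i * `|psum l a i| <= weight j * `|psum l a j|.
Proof.
move=> [_ _ l3 _]; elim: j => [|j IH] /andP[].
  by rewrite leqn0 => /eqP->.
rewrite leq_eqVlt => /predU1P[->//|ij] jl.
by apply: le_trans (l3 j a jl); apply: IH; rewrite -ltnS ij ltnW.
Qed.

(** Each term is a difference of two consecutive partial sums; this supplies the constant that
    [basic_extension] requires. *)
Lemma tree_inv_coef l a m : tree_inv l -> (m < size l)%N ->
  `|a m| <= 2 * (1 + e) * `|psum l a (size l)|.
Proof.
move=> lP ml; have le i : (i <= size l)%N ->
    `|psum l a i| <= (1 + e) * `|psum l a (size l)|.
  move=> il; have := @tree_inv_psum l a i (size l) lP; rewrite il leqnn.
  move=> /(_ isT) h; apply: le_trans (_ : weight i * `|psum l a i| <= _).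
    by rewrite ler_peMl// weight_ge1.
  by rewrite (le_trans h)// ler_wpM2r// weight_le.
have -> : `|a m| = `|psum l a m.+1 - psum l a m|.
  case: lP => l1 _ _ _.
  by rewrite psumS addrAC subrr add0r normrZ l1// mulr1.
have := ler_normB (psum l a m.+1) (psum l a m).
by have := le _ ml; have := le _ (ltnW ml); lra.
Qed.

Lemma tree_inv_extend l : tree_inv l -> exists x, tree_inv (rcons l x).
Proof.
move=> lP; have [b Tb pb] := p_surj (size l).
have nthl (x : X) i : (i < size l)%N -> (rcons l x)`_i = l`_i.
  by move=> il; rewrite nth_rcons il.
have branchl x c : T c -> (p c < size l)%N -> branch (rcons l x) c = branch l c.
  move=> Tc pc; apply: eq_branch => // i ic; apply: nthl.
  exact: leq_ltn_trans pc.
have psuml x a i : (i <= size l)%N -> psum (rcons l x) a i = psum l a i.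
  move=> il; apply: eq_bigr => m _; rewrite nthl//.
  exact: leq_trans (ltn_ord m) il.
(* The node to be filled is either the root, which uses the first round, or a child of a node placed
   earlier, where the strategy stored for the parent answers. *)
have Wb : forall F, exists x, [/\ ker_seq F x, `|x| = 1 &
    vector_wins (n - size b) U (branch (rcons l x) b)].
  case/lastP: b Tb pb => [|b k] Tb pb F.
    have [x [Fx x1 Wx]] := winsU F; exists x; split => //.
    by rewrite subn0 /branch/= pb nth_rcons ltnn eqxx.
  have kl : (p b < size l)%N by rewrite -pb p_lt.
  have bn : (size b < n)%N by have := T_size Tb; rewrite size_rcons.
  have Wb : vector_wins (n - size b) U (branch l b).
    by case: lP => _ _ _; apply => //; exact: T_belast Tb.
  move: Wb; rewrite -(subnSK bn) => /(_ F)[x [Fx x1 Wx]]; exists x; split => //.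
  rewrite size_rcons branch_rcons branchl//; last exact: T_belast Tb.
  by rewrite pb nth_rcons ltnn eqxx.
(* The ratio of consecutive weights is the room that the third clause allows for one extension. *)
have q1 : 1 < weight (size l).+1 / weight (size l).
  by rewrite ltr_pdivlMr ?weight_gt0// mul1r weight_lt.
have [F FP] := basic_extension q1 (fun a m => @tree_inv_coef l a m lP).
have [x [/ker_seq_cat[Fx nfx] x1 Wx]] := Wb (F ++ map nf l).
exists x; case: lP => l1 l2 l3 l4; split; rewrite ?size_rcons.
- move=> i; rewrite ltnS leq_eqVlt => /predU1P[->|il]; last by rewrite nthl ?l1.
  by rewrite nth_rcons ltnn eqxx.
- move=> j i ji; rewrite ltnS leq_eqVlt => /predU1P[il|il].
    rewrite il in ji *; rewrite (nthl x j ji) nth_rcons ltnn eqxx.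
    by apply/nfx/map_f; exact: mem_nth.
  by rewrite !nthl ?l2// (ltn_trans ji).
- move=> i a; rewrite ltnS leq_eqVlt => /predU1P[->|il]; last first.
    by rewrite !psuml ?l3// ltnW.
  rewrite psumS psuml// nth_rcons ltnn eqxx.
  rewrite -ler_pdivlMl ?weight_gt0// mulrA (mulrC _^-1).
  exact: (FP a _ (ker_seqZ _ Fx)).
- move=> c Tc; rewrite ltnS leq_eqVlt => /predU1P[pc|pc].
    by rewrite (p_inj Tc Tb)// pc pb.
  by rewrite branchl//; exact: l4.
Qed.

Lemma tree_exists : exists f : nat -> X, forall N, tree_inv (mkseq f N).
Proof.
apply: (seq_dependent_choice 0); last exact: tree_inv_extend.
by split.
Qed.

End tree_construction.

(** * Finite sets of positive integers as increasing lists *)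

Lemma sorted_fset_inj (b c : seq nat) : sorted ltn b -> sorted ltn c ->
  [fset k in b]%fset = [fset k in c]%fset -> b = c.
Proof.
move=> sb sc bc; apply: (irr_sorted_eq ltn_trans ltnn sb sc) => k.
by move/fsetP: bc => /(_ k); rewrite !inE.
Qed.

Lemma fset_sort (A : {fset nat}) : [fset k in sort leq A]%fset = A.
Proof. by apply/fsetP => k; rewrite !inE mem_sort. Qed.

(** Positivity of [k] is what makes the inequality strict when [b] is empty, as the empty maximum is
    0. *)
Lemma fmax_rcons_lt (b : seq nat) k :
  sorted ltn (rcons b k) -> all (leq 1) (rcons b k) ->
  (fmax [fset i in b]%fset < fmax [fset i in rcons b k]%fset)%N.
Proof.
move=> sb; rewrite all_rcons => /andP[k0 _].
have bk : all (gtn k) b.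
  have := sb; rewrite sorted_pairwise; last exact: ltn_trans.
  by rewrite pairwise_rcons => /andP[].
apply: (@leq_trans k); last first.
  rewrite /fmax; apply: (@leq_bigmax_seq _ _ xpredT id k) => //.
  by rewrite !inE mem_rcons mem_head.
rewrite -(prednK k0) ltnS; apply/bigmax_leqP_seq => i; rewrite inE => ib _.
by rewrite -ltnS prednK//; exact: (allP bk).
Qed.

(** * Verification of the good tree conditions *)

Section good_trees.
Context (R : realType) (X : normedModType R).

(** The upper bound is homogeneity; the lower one flips a sign at an index where the maximum [N] is
    attained, the case [N = 0] being trivial. *)
Lemma linfty_bounds (d : R) (s : seq X) m (a : 'I_m.+1 -> R) :
  size s = m.+1 -> (forall x, x \in s -> `|x| = 1) -> upper_linfty (1 + d) s ->
  let N := \big[Num.max/0]_(i < m.+1) `|a i| in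
  let y := \sum_(i < m.+1) a i *: s`_i in
  (1 - d) * N <= `|y| /\ `|y| <= (1 + d) * N.
Proof.
move=> sm s1 sd N y.
have aN i : `|a i| <= N by exact: (le_bigmax_cond 0 (fun i => `|a i|)).
pose a' i := if (i < m.+1)%N then a (inord i) else 0.
have N0 : 0 <= N by rewrite (le_trans _ (aN ord0)).
have a'N i : `|a' i| <= N by rewrite /a'; case: ifP => // _; rewrite normr0.
have yE : y = \sum_(i < size s) a' i *: s`_i.
  by rewrite sm; apply: eq_bigr => i _; rewrite /a' ltn_ord inord_val.
have [N00|Nn0] := eqVneq N 0.
  have -> : y = 0.
    apply: big1 => i _; have := aN i; rewrite N00 normr_le0 => /eqP->.
    by rewrite scale0r.
  by rewrite N00 !mulr0 normr0.
have {Nn0}Ngt : 0 < N by rewrite lt_neqAle eq_sym Nn0.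
split; last first.
  by rewrite mulrC; apply: (upper_linfty_cube Ngt sd); apply/cubeP => //; exists a'.
have [i _ Ni] : {i | xpredT i & N = `|a i|}
  by exact: (@eq_bigmax _ _ _ 0 ord0 xpredT (fun i => `|a i|)).
apply: (upper_linfty_lower Ngt s1 sd a'N _ _ yE (i := i)); first by rewrite sm.
by rewrite /a' ltn_ord inord_val Ni.
Qed.

Theorem good_trees : reflexive_space X ->
  unconditional_asymptotic_structure X ->
  xolt (Some omega) (szlenk_index (dual X)) ->
  good_linfty_trees_almost_isometrically X.
Proof.
move=> rX uX sX e e0 n A n0 [[AN Ainj Asurj] Amax].
have e1 : 0 < 1 + e by rewrite addr_gt0.
(* With this choice [1 - d] equals [(1 + e)^-1] and [1 + d] is at most [1 + e], so both bounds come
   out with the same constant. *)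
pose d := e / (1 + e); have d0 : 0 < d by rewrite divr_gt0.
have [M WM] := vector_wins_upper rX uX sX.
have W := vector_wins_almost_isometric d0 WM n.+1.
have [nf nfP] := choice (@exists_norming R X).
have /choice[pos posP] : forall B, exists i, Nle n B -> A i = B.
  move=> B; have [nB|nB] := pselect (Nle n B); last by exists 0%N.
  by have [i _ iB] := Asurj B nB; exists i.
have posA i : pos (A i) = i.
  by apply: Ainj; rewrite ?inE//; apply: posP; exact: AN.
have pos_lt B B' : Nle n B -> Nle n B' -> (fmax B < fmax B')%N ->
    (pos B < pos B')%N.
  by move=> nB nB' BB'; apply: Amax; rewrite !posP.
pose T (b : seq nat) := [&& sorted ltn b, all (leq 1) b & (size b <= n)%N].
pose p (b : seq nat) := pos [fset k in b]%fset.
have TN b : T b -> Nle n [fset k in b]%fset.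
  move=> /and3P[sb /allP b1 bn]; split; last by move=> k; rewrite inE => /b1.
  by rewrite card_fseq (leq_trans (size_undup b)).
have T_size b : T b -> (size b <= n)%N by case/and3P.
have T_belast b k : T (rcons b k) -> T b.
  rewrite /T all_rcons size_rcons => /and3P[sb /andP[_ ->] /ltnW->].
  by move: sb; rewrite -cats1 => /cat_sorted2[-> _].
have p_lt b k : T (rcons b k) -> (p b < p (rcons b k))%N.
  move=> Tb; apply: pos_lt; [exact/TN/(T_belast _ _ Tb)|exact: TN|].
  by case/and3P: Tb => sb b1 _; exact: fmax_rcons_lt.
have p_inj b c : T b -> T c -> p b = p c -> b = c.
  move=> Tb Tc pbc; case/and3P: (Tb) => sb _ _; case/and3P: (Tc) => sc _ _.
  apply: sorted_fset_inj => //.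
  by rewrite -(posP _ (TN b Tb)) -(posP _ (TN c Tc)) -/(p b) pbc.
have p_surj i : exists2 b, T b & p b = i.
  have [An A1] := AN i I; exists (sort leq (A i)); last by rewrite /p fset_sort.
  rewrite /T ltn_sorted_uniq_leq sort_uniq fset_uniq (sort_sorted leq_total) size_sort/=.
  by rewrite An andbT; apply/allP => k; rewrite mem_sort => /A1.
have [f fP] := tree_exists nf e0 T_size T_belast p_lt p_inj p_surj W.
have fN i N : (i < N)%N -> (mkseq f N)`_i = f i by move=> iN; rewrite nth_mkseq.
have f1 i : `|f i| = 1.
  have [l1 _ _ _] := fP i.+1; rewrite -(@fN i i.+1)//; apply: l1.
  by rewrite size_mkseq.
exists (fun B => f (pos B)), (fun B => nf (f (pos B))).
split.
- move=> B _; have [nf1 nff] := nfP (f (pos B)); split => //.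
  exact: norming_norm1 nff.
- move=> B nB; split; first by have [_ ->] := nfP (f (pos B)).
  move=> B' nB' BB'; have [_ l2 _ _] := fP (pos B').+1.
  have pBB' := pos_lt _ _ nB nB' BB'.
  have := l2 _ _ pBB'; rewrite size_mkseq ltnS leqnn => /(_ isT).
  by rewrite !fN// ltnW.
- move=> a b sb b1 N y.
  have Tb : T b by rewrite /T sb b1 size_tuple leqnn.
  (* The prefix of length [(p b).+1] just contains the node [b], and as [b] has size [n] no round
     remains: the invariant is the upper bound on the branch itself. *)
  have [_ _ _ /(_ b Tb)] := fP (p b).+1.
  rewrite size_mkseq ltnS leqnn => /(_ isT); rewrite size_tuple subnn /=.
  have -> : branch p (mkseq f (p b).+1) b =
            [seq f (p (take i b)) | i <- iota 0 n.+1].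
    rewrite /branch size_tuple; apply: eq_map => i; rewrite fN// ltnS.
    exact: (p_take T_belast p_lt).
  set s := map _ _ => sd.
  have ss : size s = n.+1 by rewrite size_map size_iota.
  have s1 x : x \in s -> `|x| = 1 by move=> /mapP[i _ ->].
  have [lo up] := linfty_bounds a ss s1 sd.
  have yE : y = \sum_(i < n.+1) a i *: s`_i.
    apply: eq_bigr => i _.
    by rewrite (nth_map 0%N) ?size_iota// nth_iota// add0n.
  rewrite -yE -/N in lo up.
  have N0 : 0 <= N
    by rewrite (le_trans (normr_ge0 (a ord0)))// (le_bigmax_cond 0 (fun i => `|a i|)).
  split.
    rewrite (le_trans _ lo)// (_ : (1 + e)^-1 = 1 - d)//.
    by rewrite /d; field; rewrite gt_eqF.
  rewrite (le_trans up)// ler_wpM2r// lerD2l ler_pdivrMr//.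
  by rewrite ler_peMr ?lerDl ?ltW.
- move=> i j a ij; have lP := fP j.
  have := tree_inv_psum a lP; move=> /(_ i j); rewrite ij size_mkseq leqnn => /(_ isT).
  have ps k : (k <= j)%N ->
      psum (mkseq f j) a k = \sum_(m < k) a m *: f (pos (A m)).
    move=> kj; apply: eq_bigr => m _; rewrite posA fN//.
    exact: leq_trans (ltn_ord m) kj.
  (* The weights lie between 1 and [1 + e], so dropping the left one and bounding the right one
     gives the basis constant. *)
  rewrite !ps// => h; apply: (le_trans _ (le_trans h _)).
    by rewrite ler_peMl// weight_ge1.
  by rewrite ler_wpM2r// weight_le.
Qed.

End good_trees.

Theorem theorem3p2 (R : realType) (X : completeNormedModType R)
    (X_separable : separable_space X)
    (X_reflexive : reflexive_space X)
    (X_unconditional : unconditional_asymptotic_structure X)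
    (X_szlenk : xolt (Some omega) (szlenk_index (dual X))) :
  good_linfty_trees_almost_isometrically X.
Proof. exact: good_trees. Qed.
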